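(* There exist a ($T_1$) topological space $X$ and a point $x\in X$ such that, for every unbounded function $f:\omega\to\mathbb{N}$, player Two has a winning strategy in the game $\mathsf{G}_f(\Omega_x,\Omega_x)$ on $X$, but $\mathsf{S}_1(\Omega_x,\Omega_x)$ fails in $X$.
   Context: All topological spaces are assumed to be $T_1$; $\mathbb{N}=\omega\setminus\{0\}$. For a space $X$ and $x\in X$, let $\Omega_x=\{A\subseteq X: x\in\overline{A}\}$. $\mathsf{S}_1(\Omega_x,\Omega_x)$ is the statement: for every sequence $(A_n)_{n\in\omega}$ of elements of $\Omega_x$ there are $a_n\in A_n$ ($n\in\omega$) with $\{a_n:n\in\omega\}\in\Omega_x$. For $f:\omega\to\mathbb{N}$, the game $\mathsf{G}_f(\Omega_x,\Omega_x)$ on $X$ is played by One and Two: in each inning $n\in\omega$, One chooses $A_n\in\Omega_x$, and then Two selects $F_n\subseteq A_n$ with $|F_n|\le f(n)$. Two wins if $\bigcup_{n\in\omega}F_n\in\Omega_x$; otherwise One wins. *)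

(* Defs.v *)
From mathcomp Require Import all_boot all_order.
From mathcomp Require Import boolp classical_sets functions cardinality.
From mathcomp Require Import topology.

Set Implicit Arguments.
Unset Strict Implicit.
Unset Printing Implicit Defensive.

Local Open Scope classical_set_scope.
Local Open Scope card_scope.

Definition Omega (X : topologicalType) (x : X) : set (set X) :=
  [set A | closure A x].

Section selection_games.
Variable X : Type.
Implicit Types (A B : set (set X)) (f : nat -> nat).

Definition S1 A B : Prop :=
  forall O : nat -> set X, (forall n, A (O n)) ->
    exists a : nat -> X, (forall n, O n (a n)) /\ B (range a).

(* A strategy for Two sends the moves [:: O_0; ...; O_n] made so far by One to
   Two's answer F_n in inning n. *)
Definition strategy := seq (set X) -> set X.

Definition answer (sigma : strategy) (O : nat -> set X) (n : nat) : set X :=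
  sigma (mkseq O n.+1).

(* Since One may continue any finite sequence of moves, the strategy obeys the
   rules of G_f(A, B) iff it does so along every infinite sequence of moves. *)
Definition winning_strategy f A B (sigma : strategy) : Prop :=
  forall O : nat -> set X, (forall n, A (O n)) ->
    (forall n, answer sigma O n `<=` O n /\ answer sigma O n #<= `I_(f n)) /\
    B (\bigcup_n answer sigma O n).

Definition Two_wins_G f A B : Prop :=
  exists sigma : strategy, winning_strategy f A B sigma.

End selection_games.

Definition unbounded (f : nat -> nat) : Prop :=
  forall m : nat, exists n : nat, (m < f n)%N.

(* Main.v *)
(** The space is [{None} ∪ ω×ω], with every pair isolated and with a set
    containing [None] open iff it omits at most [k] points of each column
    [{n}×ω], for some [k] independent of [n].  Thus a set of pairs accumulates
    at [None] iff its columns contain arbitrarily large finite sets.  If [f] is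
    unbounded, Two wins by picking in inning [n] exactly [f n] points of a
    single column.  A choice of one point from each column is closed, so the
    columns witness the failure of [S1]. *)
Require Import Defs.
From HB Require Import structures.
From mathcomp Require Import all_boot all_order.
From mathcomp Require Import boolp classical_sets functions cardinality.
From mathcomp Require Import topology.

Set Implicit Arguments.
Unset Strict Implicit.
Unset Printing Implicit Defensive.

Local Open Scope classical_set_scope.
Local Open Scope card_scope.

Definition column_fan : Type := option (nat * nat).

HB.instance Definition _ := Choice.on column_fan.

(** Lists bound the omitted points, so intersecting two open sets amounts to concatenating lists and
    adding the bounds. *)
Definition fan_open : set (set column_fan) :=
  [set U | U None -> exists k (s : nat -> seq nat),
    (forall n, size (s n) <= k) /\
    (forall n m, m \notin s n -> U (Some (n, m)))].

Lemma fan_openT : fan_open setT.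
Proof. by move=> _; exists 0, (fun=> [::]). Qed.

Lemma fan_openI (U V : set column_fan) :
  fan_open U -> fan_open V -> fan_open (U `&` V).
Proof.
move=> oU oV [/oU [k [s [sk sU]]] /oV [l [t [tl tV]]]].
exists (k + l), (fun n => s n ++ t n); split=> [n|n m].
  by rewrite size_cat leq_add.
by rewrite mem_cat negb_or => /andP[/sU ? /tV ?].
Qed.

Lemma fan_open_bigU (I : Type) (U : I -> set column_fan) :
  (forall i, fan_open (U i)) -> fan_open (\bigcup_i U i).
Proof.
move=> oU [i _ /oU [k [s [sk sU]]]]; exists k, s; split=> // n m /sU Um.
by exists i.
Qed.

HB.instance Definition _ :=
  isOpenTopological.Build column_fan fan_openT fan_openI fan_open_bigU.

Lemma openE_fan (U : set column_fan) : open U = fan_open U.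
Proof. by []. Qed.

Lemma fan_accessible : accessible_space column_fan.
Proof.
move=> x y xy; exists (~` [set y]); split; last 2 first.
- by rewrite inE /=; apply/eqP.
- by rewrite inE /= => /(_ erefl).
(* For [y = Some (i, j)], listing [j] in every column, not just column [i], is harmless: the lists
   need only cover the omitted points. *)
rewrite openE_fan => _; exists 1, (fun=> if y is Some p then [:: p.2] else [::]).
split=> [_|n m]; first by case: (y).
by case: {xy} y => [[i j]|] //=; rewrite inE => /eqP mj [_ /mj].
Qed.

(** Distinct elements of [B] are collected greedily: a list that does not yet cover [B] can be
    extended by a missed element. *)
Lemma uniq_subset_or_cover (B : set nat) (k : nat) :
  (exists t, [/\ uniq t, size t = k & [set` t] `<=` B]) \/
  (exists2 s, size s <= k & B `<=` [set` s]).
Proof.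
elim: k => [|k [[t [t_uniq <- tB]]|[s sk Bs]]]; first by left; exists [::].
- have [Bt|] := pselect (B `<=` [set` t]); first by right; exists t.
  move=> /existsNP[m /not_implyP[Bm /= /negP mt]].
  left; exists (m :: t); split; rewrite /= ?mt // => i /=.
  by rewrite inE => /orP[/eqP ->|/tB].
- by right; exists s => //; exact: leqW.
Qed.

Lemma uniq_not_covered (t s : seq nat) :
  uniq t -> size s < size t -> exists2 m, m \in t & m \notin s.
Proof.
move=> t_uniq st; apply/hasP; rewrite has_predC; apply/negP => /allP ts.
by have := uniq_leq_size t_uniq ts; rewrite leqNgt st.
Qed.

(** The first alternative covers sets containing [None], which have it in their closure whatever
    their columns. *)
Definition thick (k : nat) (A : set column_fan) : Prop :=
  A None \/ exists n t,
    [/\ uniq t, size t = k & forall m, m \in t -> A (Some (n, m))].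

(** If no column of [A] has [k] points, uniformly short lists cover its columns and the complement
    of [A] is a neighbourhood of [None]. Conversely, an open set omitting at most [k] points per
    column must meet any [k.+1] points of one column. *)
Lemma Omega_None (A : set column_fan) :
  Omega (None : column_fan) A <-> forall k, exists2 l, k <= l & thick l A.
Proof.
split=> [clA k|thickA U].
  exists k => //; have [|notA] := pselect (A None); first by left.
  right; apply: contrapT => /forallNP small.
  have /choice[s sA] n : exists s, size s <= k /\
      forall m, A (Some (n, m)) -> m \in s.
    have [[t [tu tk tA]]|[s sk sA]] :=
      uniq_subset_or_cover [set m | A (Some (n, m))] k.
      by case: (small n); exists t.
    by exists s; split.
  have : nbhs (None : column_fan) (~` A).
    apply: open_nbhs_nbhs; split=> //; rewrite openE_fan => _.
    exists k, s; split=> [n|n m /negP ms /(proj2 (sA n))//].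
    by case: (sA n).
  by move=> /clA [? []].
rewrite nbhsE => -[V [oV VN] VU].
move: oV; rewrite openE_fan => /(_ VN) [k [s [sk sV]]].
have [l kl [AN|[n [t [tu tl tA]]]]] := thickA k.+1.
  by exists None; split=> //; exact: VU.
have [|m mt ms] := @uniq_not_covered t (s n) tu.
  by rewrite tl; exact: leq_ltn_trans (sk n) kl.
by exists (Some (n, m)); split; [exact: tA|exact/VU/sV].
Qed.

Lemma thick_subset k (A B : set column_fan) :
  A `<=` B -> thick k A -> thick k B.
Proof.
move=> AB [/AB|[n [t [tu tk tA]]]]; first by left.
by right; exists n, t; split=> // m /tA/AB.
Qed.

(* Shrinks [t] to its first [k] elements, since [Omega_None] only provides
   some size [l >= k]. *)
Lemma Omega_thick_subset (A : set column_fan) (k : nat) :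
  Omega (None : column_fan) A -> 0 < k ->
  exists F, [/\ F `<=` A, F #<= `I_k & thick k F].
Proof.
move=> /Omega_None/(_ k)[l kl [AN|[n [t [tu tl tA]]]]] k0.
  (* This image is the singleton of [None], since [0 < k]; writing it as an image of [I_k] gives the
     cardinality bound. *)
  exists ((fun=> None) @` `I_k); split; last by left; exists 0.
    by move=> _ [i _ <-].
  exact: card_image_le.
exists ((fun i => Some (n, nth 0 t i)) @` `I_k); split.
- by move=> _ [i ik <-]; apply: tA; rewrite mem_nth// tl (leq_trans ik).
- exact: card_image_le.
- right; exists n, (take k t); split; first exact: take_uniq.
    by rewrite size_takel ?tl.
  move=> m /(nthP 0)[i]; rewrite size_takel ?tl// => ik <-.
  by exists i => //; rewrite nth_take.
Qed.

(** In inning [n] the history has length [n.+1], hence the predecessor. Only the last move of One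
    matters. *)
Definition fan_strategy (f : nat -> nat) : strategy column_fan := fun s =>
  let k := f (size s).-1 in
  xget set0 [set F | [/\ F `<=` last set0 s, F #<= `I_k & thick k F]].

Lemma fan_strategy_winning (f : nat -> nat) :
  (forall n, 0 < f n) -> unbounded f ->
  winning_strategy f (Omega (None : column_fan)) (Omega (None : column_fan))
    (fan_strategy f).
Proof.
move=> f0 f_unb O OP.
have ans n : [/\ answer (fan_strategy f) O n `<=` O n,
    answer (fan_strategy f) O n #<= `I_(f n)
    & thick (f n) (answer (fan_strategy f) O n)].
  rewrite /answer /fan_strategy -nth_last size_mkseq /= nth_mkseq//.
  case: xgetP => [F _ //|noF].
  by have [F /noF] := Omega_thick_subset (OP n) (f0 n).
split=> [n|]; first by case: (ans n).
apply/Omega_None => k; have [n kn] := f_unb k; exists (f n); first exact: ltnW.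
by case: (ans n) => _ _; apply: thick_subset => y yn; exists n.
Qed.

Lemma fan_not_S1 : ~ S1 (Omega (None : column_fan)) (Omega (None : column_fan)).
Proof.
move=> /(_ (fun n => [set Some (n, m) | m in setT])) [n|a [aO]].
  apply/Omega_None => k; exists k => //; right; exists n, (iota 0 k).
  by split=> [||m _]; rewrite ?iota_uniq ?size_iota//; exists m.
have aE n m i : a i = Some (n, m) -> i = n.
  by move=> ai; have [j _] := aO i; rewrite ai => -[].
(* Thickness 2 is already contradictory: by [aE], column [n] contains only the point chosen in
   inning [n]. *)
move=> /Omega_None/(_ 2)[l l2 [[i _ ai]|[n [t [tu tl ta]]]]].
  by have [j _] := aO i; rewrite ai.
have [m0 _ am0] := aO n.
have [|m /ta[i _ ai]] := @uniq_not_covered t [:: m0] tu; first by rewrite tl.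
by move: ai (ai) => /aE ->; rewrite -am0 => -[->]; rewrite inE eqxx.
Qed.

Theorem mainTheorem3 :
  exists (X : topologicalType) (x : X),
    accessible_space X /\
    (forall f : nat -> nat,
       (forall n : nat, (0 < f n)%N) -> unbounded f ->
       Two_wins_G f (Omega x) (Omega x)) /\
    ~ S1 (Omega x) (Omega x).
Proof.
exists column_fan, None; split; first exact: fan_accessible.
split=> [f f0 f_unb|]; last exact: fan_not_S1.
by exists (fan_strategy f); exact: fan_strategy_winning.
Qed.
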